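(* Let $F:[0,1]\to\mathfrak J$ be Hölder continuous with exponent $\nu$ and constant $L$, i.e. $d_\mu(F(x),F(y))\le L|x-y|^\nu$ for all $x,y\in[0,1]$. Then for all $n\in\mathbb N$, $n\ge1$, and all $x\in[0,1]$, $$d_\mu\big(F(x),B_n(F,x)\big)\le L\Big(\frac1n\Big)^{\nu}+L\Big(\frac{x(1-x)}{n}\Big)^{\nu/2},$$ where $B_n(F,x)=\bigotimes_{i=0}^n\binom ni x^i(1-x)^{n-i}F\big(\tfrac in\big)$ is the set-valued Bernstein operator (a partition average).
   Context: Here $\nu>0$, $L\ge0$. Fix $m\ge1$ and let $\mu$ be Lebesgue measure on $\mathbb R^m$. $\mathbb J$ denotes the collection of Jordan measurable subsets of $\mathbb R^m$ (bounded sets whose boundary has Lebesgue measure zero). $\operatorname{ci}(A)$ is the closure of the interior of $A$; a bounded set $A$ is regular compact if $A=\operatorname{ci}(A)$. $\mathfrak J\subset\mathbb J$ is the collection of regular compact sets in $\mathbb J$ (including $\emptyset$), with the metric $d_\mu(A,B)=\mu(A\Delta B)$, $\Delta$ being symmetric difference. A subset-generating function is a map $\Psi:\mathbb J\times[0,1]\to\mathfrak J$ such that for all $A\in\mathbb J$ and $s,t\in[0,1]$: (1) $\Psi(A,t)\subseteq A$ up to a null set, i.e. $\mu(\Psi(A,t)\setminus A)=0$; (2) $\mu(\Psi(A,t))=t\,\mu(A)$; (3) $\Psi(A,s)\subseteq\Psi(A,t)$ if $s\le t$. A subset-generating function $\Psi$ is fixed. For $A_0,\dots,A_n\in\mathfrak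 J$ and nonempty $\chi\subseteq\{0,\dots,n\}$ put $\Omega_\chi=\big(\bigcap_{k\in\chi}A_k\big)\setminus\big(\bigcup_{l\in\{0,\dots,n\}\setminus\chi}A_l\big)$, and $\Omega_\emptyset=\emptyset$. For weights $\alpha_i\in[0,1]$ with $\sum_i\alpha_i=1$, the partition average is $\bigotimes_{i=0}^n\alpha_iA_i:=\bigcup_{\chi\subseteq\{0,\dots,n\}}\Psi\big(\Omega_\chi,\sum_{k\in\chi}\alpha_k\big)\in\mathfrak J$. *)

(* Defs.v *)
From HB Require Import structures.
From mathcomp Require Import all_boot all_order all_algebra.
From mathcomp Require Import all_classical all_reals all_analysis.

Set Implicit Arguments.
Unset Strict Implicit.
Unset Printing Implicit Defensive.

Import Order.TTheory GRing.Theory Num.Theory.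
Import numFieldNormedType.Exports.

Local Open Scope classical_set_scope.
Local Open Scope ring_scope.

Section lebesgue_measure_rV.
Context {R : realType} {m : nat}.
Implicit Types (A : set 'rV[R]_m) (ab : 'rV[R]_m * 'rV[R]_m).

(* A pair (a, b) encodes the closed box [a_0, b_0] x ... x [a_(m-1), b_(m-1)]. *)
Definition box ab : set 'rV[R]_m :=
  [set x | forall i, ab.1 ord0 i <= x ord0 i <= ab.2 ord0 i].

Definition box_volume ab : R := \prod_(i < m) (ab.2 ord0 i - ab.1 ord0 i).

Definition box_cover A :=
  [set B : nat -> 'rV[R]_m * 'rV[R]_m |
    (forall k i, (B k).1 ord0 i <= (B k).2 ord0 i) /\
    A `<=` \bigcup_k box (B k)].

(* Like lebesgue_measure on R, this function is defined on all sets: it is the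
   Lebesgue outer measure, whose restriction to its Caratheodory-measurable
   sets is the (complete) Lebesgue measure.  It is only meaningful for 0 < m:
   in dimension 0 every box has volume 1. *)
Definition lebesgue_measure_rV A : \bar R :=
  ereal_inf [set (\sum_(k <oo) (box_volume (B k))%:E)%E | B in box_cover A].

End lebesgue_measure_rV.

Section lebesgue_measure_rV_outer_measure.
Context {R : realType} {m : nat}.
Local Notation mu := (@lebesgue_measure_rV R m.+1).
Local Open Scope ereal_scope.

Lemma box_volume_ge0 (ab : 'rV[R]_m.+1 * 'rV[R]_m.+1) :
  (forall i, ab.1 ord0 i <= ab.2 ord0 i)%R -> (0 <= box_volume ab)%R.
Proof. by move=> hB; apply: prodr_ge0 => i _; rewrite subr_ge0. Qed.

Lemma lebesgue_measure_rV_ge0 A : 0 <= mu A.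
Proof.
apply: le_ereal_inf_tmp => _ [B [hB _] <-].
by apply: nneseries_ge0 => k _ _; rewrite lee_fin box_volume_ge0.
Qed.

Lemma lebesgue_measure_rV0 : mu set0 = 0.
Proof.
apply/eqP; rewrite eq_le lebesgue_measure_rV_ge0 andbT.
apply: ereal_inf_lbound; exists (fun=> (0%R, 0%R)); first by split.
apply: eseries0 => k _ _; congr (_%:E).
by rewrite /box_volume big_ord_recl /= subrr mul0r.
Qed.

Lemma le_lebesgue_measure_rV : {homo mu : A B / A `<=` B >-> A <= B}.
Proof.
move=> A B AB; apply/ereal_inf_le_tmp => _ [C [hC BC] <-].
by exists C => //; split => //; exact: subset_trans BC.
Qed.

Lemma lebesgue_measure_rV_sigma_subadditive : sigma_subadditive mu.
Proof.
move=> A; have [[i ioo]|] := pselect (exists i, mu (A i) = +oo).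
  rewrite (eseries_pinfty _ _ ioo) ?leey// => n _.
  by rewrite -ltNye (lt_le_trans _ (lebesgue_measure_rV_ge0 _)).
rewrite -forallNE => Aoo.
apply/lee_addgt0Pr => _/posnumP[e].
rewrite (le_trans _ (epsilon_trick _ _ _))//; last first.
  by move=> n; exact: lebesgue_measure_rV_ge0.
pose P n (B : nat -> 'rV[R]_m.+1 * 'rV[R]_m.+1) := box_cover (A n) B /\
  \sum_(k <oo) (box_volume (B k))%:E <= mu (A n) + (e%:num / (2 ^ n.+1)%:R)%:E.
have [G PG] : {G & forall n, P n (G n)}.
  apply: (@choice _ _ P) => n; rewrite /P /lebesgue_measure_rV.
  set S := (X in ereal_inf X); move infS : (ereal_inf S) => iS.
  case: iS infS => [r Sr|Soo|Soo].
  - have en1 : (0 < e%:num / (2 ^ n.+1)%:R)%R by [].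
    have /(lb_ereal_inf_adherent en1) : ereal_inf S \is a fin_num by rewrite Sr.
    move=> [x [B [mB AnB] muBx] xS].
    by exists B; split => //; rewrite muBx -Sr; exact/ltW.
  - by have := Aoo n; rewrite /lebesgue_measure_rV Soo.
  - by have := lebesgue_measure_rV_ge0 (A n); rewrite /lebesgue_measure_rV Soo.
pose v (p : nat * nat) : \bar R := (box_volume (G p.1 p.2))%:E.
have v0 p : 0 <= v p by rewrite lee_fin box_volume_ge0//; exact: (PG p.1).1.1.
apply: (@le_trans _ _ (\esum_(i in setT) v i)).
  apply: ereal_inf_lbound => /=.
  have /card_esym/ppcard_eqP[f] := card_nat2.
  exists (fun k => G (f k).1 (f k).2).
    split => [k i|t [i _ Ait]]; first exact: (PG _).1.1.
    have [j _ Bijt] := (PG i).1.2 _ Ait.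
    by exists (f^-1%FUN (i, j)) => //=; rewrite invK ?inE.
  rewrite -[LHS]/(\sum_(k <oo) (v \o f) k).
  rewrite nneseries_esumT; last by move=> k; exact: v0.
  by rewrite -(@reindex_esum _ _ _ setT setT f).
rewrite (_ : esum _ _ = \sum_(i <oo) \sum_(j <oo) v (i, j)); last first.
  have -> : [set: nat * nat] = setT `*`` (fun=> setT) by apply/seteqP; split.
  rewrite -(@esum_esum _ _ _ setT (fun=> setT) (fun i j => v (i, j)))//.
  rewrite nneseries_esumT => [|i]; last by apply: nneseries_ge0 => j _ _.
  by apply: eq_esum => i _; rewrite nneseries_esumT.
apply: lee_nneseries => [i _ _|i _].
  by apply: nneseries_ge0 => j _ _; exact: v0.
exact: (PG i).2.
Qed.

HB.instance Definition _ := isOuterMeasure.Build R 'rV[R]_m.+1 mu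
  lebesgue_measure_rV0 lebesgue_measure_rV_ge0 le_lebesgue_measure_rV
  lebesgue_measure_rV_sigma_subadditive.

End lebesgue_measure_rV_outer_measure.

Section jordan.
Context {R : realType} {m : nat}.
Local Notation mu := (@lebesgue_measure_rV R m).
Implicit Types (A B : set 'rV[R]_m).

Definition boundary A := closure A `\` A°.

Definition jordan_measurable A := bounded_set A /\ mu (boundary A) = 0%E.

Definition ci A := closure A°.

Definition regular_compact A := bounded_set A /\ A = ci A.

Definition regular_jordan A := regular_compact A /\ jordan_measurable A.

Definition dmu A B : \bar R := mu (A `+` B).

Record subset_generating (Psi : set 'rV[R]_m -> R -> set 'rV[R]_m) : Prop := {
  subset_generating_regular : forall A (t : R), jordan_measurable A -> 0 <= t <= 1 ->
    regular_jordan (Psi A t) ;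
  subset_generating_sub : forall A (t : R), jordan_measurable A -> 0 <= t <= 1 ->
    mu (Psi A t `\` A) = 0%E ;
  subset_generating_measure : forall A (t : R), jordan_measurable A -> 0 <= t <= 1 ->
    mu (Psi A t) = (t%:E * mu A)%E ;
  subset_generating_mono : forall A (s t : R), jordan_measurable A ->
    0 <= s <= 1 -> 0 <= t <= 1 -> s <= t -> Psi A s `<=` Psi A t }.

Definition Omega n (A : 'I_n.+1 -> set 'rV[R]_m) (chi : {set 'I_n.+1}) :=
  if chi == finset.set0 then set0
  else (\bigcap_(k in [set` chi]) A k) `\` (\bigcup_(l in [set` ~: chi]) A l).

Definition partition_average (Psi : set 'rV[R]_m -> R -> set 'rV[R]_m) n
    (alpha : 'I_n.+1 -> R) (A : 'I_n.+1 -> set 'rV[R]_m) : set 'rV[R]_m :=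
  \bigcup_(chi in [set: {set 'I_n.+1}])
    Psi (Omega A chi) (\sum_(k in chi) alpha k).

Definition bernstein_operator (Psi : set 'rV[R]_m -> R -> set 'rV[R]_m) n
    (F : R -> set 'rV[R]_m) (x : R) : set 'rV[R]_m :=
  partition_average Psi
    (fun i : 'I_n.+1 => 'C(n, i)%:R * x ^+ i * (1 - x) ^+ (n - i))
    (fun i : 'I_n.+1 => F (i%:R / n%:R)).

End jordan.

(* Main.v *)
(* For a node [A_j], the pieces [Omega_chi] with [j \in chi] tile [A_j], and the
   average keeps a fraction [alpha_chi := \sum_(k in chi) alpha_k] of each piece.
   Hence the distance from [A_j] to the average is at most the sum over [chi] of
   [mu(Omega_chi)] times the total weight of the [i] separated from [j] by [chi],
   that is, at most [\sum_i alpha_i d(A_j, A_i)].  This fails for sets other than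
   the nodes (an arbitrary set may meet [Psi(Omega_chi, t)] badly), so one passes
   from [F x] to [F (j / n)] with [j / n] the node nearest to [x].

   Put [d := |n x - j| <= 1/2], [S := n x (1 - x)] and [u := nu / 2].  Jensen's
   inequality and the variance of the binomial law bound the total error by
   [L n^-nu (d^(2u) + (S + d^2)^u)].  As [j / n] is nearest, [d^2 <= S], and then
   concavity gives [d^(2u) + (S + d^2)^u <= 1 + S^u] for [u <= 1].  For [nu >= 2],
   [F] is constant up to null sets and there is nothing to prove.

   The measure in the statement is an outer measure, so additivity on the pieces
   needs Jordan sets to be Caratheodory measurable: half-spaces are, by cutting
   the boxes of a cover, hence so are boxes, open sets and, up to a null boundary,
   Jordan sets. *)
Require Import Defs.
From mathcomp Require Import all_boot all_order all_algebra.
From mathcomp Require Import all_classical all_reals all_analysis.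
From mathcomp Require Import ring lra.

Set Implicit Arguments.
Unset Strict Implicit.
Unset Printing Implicit Defensive.

Import Order.TTheory GRing.Theory Num.Theory.
Import numFieldNormedType.Exports.

Local Open Scope classical_set_scope.
Local Open Scope ring_scope.

(** * Concavity of real powers *)

Section powR.
Context {R : realType}.
Implicit Types (u x y : R).

(** Young's inequality for the product of [y^u] and [1], with exponents [1/u] and [1/(1 - u)]; the
    second requires [u < 1], so [u = 1] is treated apart. *)
Lemma powR_le_tangent y u : 0 <= y -> 0 < u <= 1 -> y `^ u <= 1 + u * (y - 1).
Proof.
move=> y0 /andP[u0]; rewrite le_eqVlt => /predU1P[->|u1].
  by rewrite powRr1// mul1r addrC subrK.
have u1' : 0 < 1 - u by rewrite subr_gt0.
have := @conjugate_powR R (y `^ u) 1 u^-1 (1 - u)^-1 (powR_ge0 _ _) ler01.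
rewrite !invr_gt0 !invrK subrKC mulr1 => /(_ u0 u1' erefl).
rewrite -powRrM mulfV ?gt_eqF// powRr1// powR1.
lra.
Qed.

(** The power lies below its tangent at the mean [T]; averaging the tangent gives [T^u]. Normalising
    by [T] forces a separate case [T = 0]. *)
Lemma powR_jensen n (alpha t : 'I_n -> R) u :
  (forall i, 0 <= alpha i) -> \sum_i alpha i = 1 -> (forall i, 0 <= t i) ->
  0 < u <= 1 -> \sum_i alpha i * t i `^ u <= (\sum_i alpha i * t i) `^ u.
Proof.
move=> alpha0 alpha1 t0 u01; have /andP[u0 _] := u01.
have at0 i : 0 <= alpha i * t i by rewrite mulr_ge0.
set T := \sum_i alpha i * t i.
have : 0 <= T by apply: sumr_ge0.
rewrite le_eqVlt => /predU1P[T0|T0].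
  have at_eq0 i : alpha i * t i = 0.
    by move: (psumr_eq0P (fun i _ => at0 i) (esym T0)) => ->.
  rewrite big1 ?powR_ge0// => i _.
  have /eqP := at_eq0 i; rewrite mulf_eq0 => /orP[/eqP ->|/eqP ->].
    by rewrite mul0r.
  by rewrite powR0 ?mulr0// gt_eqF.
apply: (@le_trans _ _ (\sum_i (alpha i * T `^ u * (1 - u) +
    alpha i * t i * (T `^ u * u / T)))); last first.
  rewrite big_split/= -!mulr_suml alpha1 -/T.
  by rewrite mul1r mulrCA divff ?gt_eqF// mulr1 -mulrDr subrK mulr1.
apply: ler_sum => i _.
have -> : t i `^ u = T `^ u * (t i / T) `^ u.
  by rewrite -powRM ?divr_ge0 ?(ltW T0)// mulrC divfK ?gt_eqF.
have := powR_le_tangent (divr_ge0 (t0 i) (ltW T0)) u01.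
move=> /(ler_wpM2l (powR_ge0 T u)) /(ler_wpM2l (alpha0 i)) /le_trans; apply.
rewrite le_eqVlt; apply/orP; left; apply/eqP.
by field; rewrite gt_eqF.
Qed.

(** With [e = d^2 <= S], the tangent at [S] gives [(S + e)^u <= S^u + u (e / S) S^u <= S^u + u e^u].
    It remains that [(1 + u) e^u <= 1], which follows from [d^u <= (1/2)^u <= 1 - u/2]. *)
Lemma powR_nearest_node_bound d S u :
  0 <= d <= 1 / 2 -> d ^+ 2 <= S -> 0 < u <= 1 ->
  d `^ (2 * u) + (S + d ^+ 2) `^ u <= 1 + S `^ u.
Proof.
move=> /andP[d0 d12] dS u01; have /andP[u0 u1] := u01.
rewrite powRrM powR_mulrn//.
move: d0; rewrite le_eqVlt => /predU1P[<-|d0].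
  by rewrite expr0n/= addr0 powR0 ?gt_eqF// add0r lerDr.
have S0 : 0 < S by rewrite (lt_le_trans _ dS)// exprn_gt0.
have e0 : 0 < d ^+ 2 by rewrite exprn_gt0.
have du : d `^ u <= 1 - u / 2.
  apply: (@le_trans _ _ ((1 / 2) `^ u)).
    by apply: ge0_ler_powR; rewrite ?nnegrE ?(ltW u0) ?(ltW d0)//; lra.
  have /le_trans := @powR_le_tangent (1 / 2) u ltac:(lra) u01; apply.
  lra.
have eu : (1 + u) * (d ^+ 2) `^ u <= 1.
  have -> : (d ^+ 2) `^ u = d `^ u ^+ 2.
    by rewrite -(powR_mulrn 2 (ltW d0)) -powRrM mulrC powRrM powR_mulrn ?powR_ge0.
  have := powR_ge0 d u.
  move: (d `^ u) du => p du p0.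
  have : p ^+ 2 <= (1 - u / 2) ^+ 2 by rewrite ler_sqr ?nnegrE; lra.
  move=> /(ler_wpM2l (_ : 0 <= 1 + u)) => /(_ ltac:(lra)) /le_trans; apply.
  (* The product equals [1 - u^2 (3 - u) / 4]. *)
  nra.
have key : (S + d ^+ 2) `^ u <= S `^ u + u * (d ^+ 2 / S * S `^ u).
  have -> : S + d ^+ 2 = S * (1 + d ^+ 2 / S) by field; rewrite gt_eqF.
  have r0 : 0 <= d ^+ 2 / S by rewrite divr_ge0// ltW.
  rewrite powRM ?addr_ge0// ?(ltW S0)//.
  have := @powR_le_tangent (1 + d ^+ 2 / S) u (addr_ge0 ler01 r0) u01.
  move=> /(ler_wpM2l (powR_ge0 S u)) /le_trans; apply.
  by rewrite addrAC subrr add0r; lra.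
suff : d ^+ 2 / S * S `^ u <= (d ^+ 2) `^ u.
  move=> /(ler_wpM2l (ltW u0)); lra.
set r := d ^+ 2 / S.
have r01 : 0 < r <= 1 by rewrite divr_gt0//= ler_pdivrMr// mul1r.
have -> : d ^+ 2 = r * S by rewrite divfK ?gt_eqF.
have /andP[r0 r1] := r01.
by rewrite powRM ?(ltW r0) ?(ltW S0)// ler_wpM2r ?powR_ge0// ger1_powR.
Qed.

End powR.

(** * Moments of the Bernstein weights *)

Section bernstein.
Context {R : comPzRingType}.
Implicit Types x y : R.

(** The absorption identity [(i+1) C(n+1, i+1) = (n+1) C(n, i)] trades a factor [i] for one degree.
    One use yields the mean, a second one the second moment. *)
Lemma sum_mul_binomial n x y (f : nat -> R) :
  \sum_(i < n.+2) 'C(n.+1, i)%:R * x ^+ i * y ^+ (n.+1 - i) * (i%:R * f i) =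
  n.+1%:R * x * \sum_(i < n.+1) 'C(n, i)%:R * x ^+ i * y ^+ (n - i) * f i.+1.
Proof.
rewrite big_ord_recl mul0r mulr0 add0r mulr_sumr; apply: eq_bigr => i _.
rewrite /= /bump/= add1n subSS exprS.
have /(congr1 (GRing.natmul (1 : R))) := mul_bin_diag n.+1 i.
rewrite /= !natrM => E.
transitivity (i.+1%:R * 'C(n.+1, i.+1)%:R * (x * x ^+ i * y ^+ (n - i) * f i.+1)).
  by ring.
by rewrite -E; ring.
Qed.

Lemma sum_bernstein n x :
  \sum_(i < n.+1) 'C(n, i)%:R * x ^+ i * (1 - x) ^+ (n - i) = 1.
Proof.
transitivity ((1 - x + x) ^+ n); last by rewrite subrK expr1n.
rewrite exprDn; apply: eq_bigr => i _.
by rewrite -[RHS]mulr_natl; ring.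
Qed.

Lemma bernstein_mean n x :
  \sum_(i < n.+1) 'C(n, i)%:R * x ^+ i * (1 - x) ^+ (n - i) * i%:R = n%:R * x.
Proof.
case: n => [|n]; first by rewrite big_ord1 !mul0r mulr0.
under eq_bigr do rewrite -[X in _ * X]mulr1.
rewrite (sum_mul_binomial _ _ _ (fun=> 1)).
under eq_bigr do rewrite mulr1.
by rewrite sum_bernstein mulr1.
Qed.

Lemma bernstein_mean_sqr n x :
  \sum_(i < n.+1) 'C(n, i)%:R * x ^+ i * (1 - x) ^+ (n - i) * i%:R ^+ 2 =
  n%:R * x * (1 - x) + (n%:R * x) ^+ 2.
Proof.
case: n => [|n]; first by rewrite big_ord1/= mulr0n; ring.
rewrite (sum_mul_binomial _ _ _ (fun i => i%:R)).
under eq_bigr do rewrite -[X in _ * X]natr1 mulrDr mulr1.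
rewrite big_split/= bernstein_mean sum_bernstein -[n.+1%:R]natr1.
by ring.
Qed.

(** Variance plus squared bias: the centre [y] will be a node, not the mean [n x]. *)
Lemma bernstein_sqr_dist n x y :
  \sum_(i < n.+1) 'C(n, i)%:R * x ^+ i * (1 - x) ^+ (n - i) * (i%:R - y) ^+ 2 =
  n%:R * x * (1 - x) + (n%:R * x - y) ^+ 2.
Proof.
set w := fun i : 'I_n.+1 => 'C(n, i)%:R * x ^+ i * (1 - x) ^+ (n - i).
transitivity (\sum_i (w i * i%:R ^+ 2 + w i * i%:R * (- (2 * y)) + w i * y ^+ 2)).
  by apply: eq_bigr => i _; rewrite /w; ring.
rewrite !big_split/= -!mulr_suml bernstein_mean_sqr bernstein_mean sum_bernstein.
by ring.
Qed.

End bernstein.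

(** The endpoints [0] and [n] are nodes themselves, whence the last two bounds; these serve to
    compare the squared distance with the variance. *)
Lemma nearest_node (R : realType) n (y : R) : 0 <= y <= n%:R ->
  exists j : 'I_n.+1, [/\ `|y - j%:R| <= 1 / 2, `|y - j%:R| <= y &
    `|y - j%:R| <= n%:R - y].
Proof.
move=> /andP[y0 yn]; set k := Num.truncn y.
have /andP[ky yk] := truncn_itv y0; rewrite -/k in ky yk.
have kn : (k <= n)%N by rewrite -(ler_nat R) (le_trans ky).
have [kn'|] := ltnP k n; last first.
  move=> nk; have yE : y = k%:R.
    by apply/eqP; rewrite eq_le ky andbT (le_trans yn)// ler_nat.
  exists (Ordinal (kn : (k < n.+1)%N)); rewrite /= yE subrr normr0.
  by split; rewrite -?yE ?subr_ge0//; lra.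
have k1n : k%:R + 1 <= n%:R :> R by rewrite natr1 ler_nat.
have y1 : y < k%:R + 1 by rewrite natr1.
have k0 : 0 <= k%:R :> R by [].
have [|] := leP (y - k%:R) (1 / 2) => h.
  exists (Ordinal (kn : (k < n.+1)%N)) => /=.
  by rewrite ger0_norm ?subr_ge0//; split; lra.
exists (Ordinal (kn' : (k.+1 < n.+1)%N)) => /=.
rewrite -natr1 ler0_norm; last lra.
by split; lra.
Qed.

(** * Caratheodory measurability of Jordan sets *)

Section outer_measure_families.
Context {R : realType} {T : Type} (mu : {outer_measure set T -> \bar R}).
Local Open Scope ereal_scope.

Lemma outer_measure_bigcup_seq (I : choiceType) (s : seq I) (A : I -> set T) :
  mu (\bigcup_(i in [set` s]) A i) <= \sum_(i <- s) mu (A i).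
Proof.
elim: s => [|i s IH].
  rewrite big_nil (_ : bigcup _ _ = set0) ?outer_measure0//.
  by apply/seteqP; split => [x [k]|].
rewrite big_cons; apply: le_trans (leeD (lexx _) IH).
apply: le_trans (outer_measureU2 _ _ _); apply: le_outer_measure => x [k /= + Akx].
by rewrite inE => /predU1P[<-|ks]; [left|right; exists k].
Qed.

(** Cutting [X] along [A i] splits its measure exactly, and the later sets, disjoint from [A i],
    only see the remainder. *)
Lemma caratheodory_sum_le (I : choiceType) (s : seq I) (A : I -> set T) :
  uniq s -> (forall i, mu.-caratheodory (A i)) -> trivIset setT A ->
  forall X, \sum_(i <- s) mu (X `&` A i) <= mu X.
Proof.
move=> + mA tA; elim: s => [|i s IH] /= => [_ X|/andP[iNs us] X].
  by rewrite big_nil outer_measure_ge0.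
rewrite big_cons (mA i X); apply: leeD => //.
apply: le_trans (IH us (X `&` ~` A i)).
rewrite big_seq [leRHS]big_seq; apply: lee_sum => k ks.
apply: le_outer_measure => x [Xx Akx]; split => //; split => // Aix.
have /trivIsetP/(_ i k Logic.I Logic.I) := tA.
have /[swap] /[apply] : i != k by apply: contraNneq iNs => ->.
by move/seteqP => [+ _] => /(_ x (conj Aix Akx)).
Qed.

Lemma outer_measure_null_caratheodory A : mu A = 0 -> mu.-caratheodory A.
Proof.
move=> A0; apply: le_caratheodory_measurable => X.
rewrite (_ : mu (X `&` A) = 0) ?add0e; first exact: le_outer_measure.
apply/eqP; rewrite eq_le outer_measure_ge0 andbT -A0.
exact: le_outer_measure.
Qed.

Lemma caratheodory_countable_bigcup (I : countType) (A : I -> set T) :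
  (forall i, mu.-caratheodory (A i)) -> mu.-caratheodory (\bigcup_i A i).
Proof.
move=> mA; pose F k := if unpickle k is Some i then A i else set0.
have -> : \bigcup_i A i = \bigcup_k F k.
  apply/seteqP; split => [x [i _ Aix]|x [k _]].
    by exists (pickle i) => //; rewrite /F pickleK.
  by rewrite /F; case: unpickle => // i Aix; exists i.
apply: caratheodory_measurable_bigcup => k; rewrite /F.
by case: unpickle => [i|]; [exact: mA|exact: caratheodory_measurable_set0].
Qed.

End outer_measure_families.

(* Unlike [ex_bound], whose filter must be proper, this covers the empty set. *)
Lemma bounded_setP (K : realType) (V : normedModType K) (A : set V) :
  bounded_set A <-> exists M, A `<=` [set x | `|x| <= M].
Proof.
split=> [[M [_ AM]]|[M AM]].
  by exists (M + 1) => x; apply: AM; rewrite ltrDl.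
by exists M; split => [|N /ltW MN x /AM]; [exact: num_real|move=> /le_trans; exact].
Qed.

Section lebesgue_caratheodory.
Context {R : realType} {m : nat}.
Local Notation mu := (@lebesgue_measure_rV R m.+1).
Implicit Types (A : set 'rV[R]_m.+1).

Definition row_set (a : 'rV[R]_m.+1) i c : 'rV[R]_m.+1 :=
  \row_j (if j == i then c else a ord0 j).

Lemma box_volume_split a b i c :
  box_volume (a, row_set b i c) + box_volume (row_set a i c, b) = box_volume (a, b).
Proof.
rewrite /box_volume /= !(bigD1 (P := xpredT) i)//=.
rewrite (eq_bigr (fun j => b ord0 j - a ord0 j)); last first.
  by move=> j /negbTE ji; rewrite mxE ji.
rewrite [X in _ + _ * X](eq_bigr (fun j => b ord0 j - a ord0 j)); last first.
  by move=> j /negbTE ji; rewrite mxE ji.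
by rewrite !mxE eqxx; ring.
Qed.

(* The face [x_i = c] is left free so that both the open and the closed
   half-space are covered. *)
Lemma half_space_caratheodory (i : 'I_m.+1) (c : R) (H : set 'rV[R]_m.+1) :
  (forall x : 'rV[R]_m.+1, x ord0 i < c -> H x) ->
  (forall x, H x -> x ord0 i <= c) ->
  mu.-caratheodory H.
Proof.
move=> ltH Hle; apply: le_caratheodory_measurable => X.
apply: le_ereal_inf_tmp => _ [B [hB XB] <-].
(* [c] clamped to the [i]-th side of the [k]-th box, so that both halves keep ordered corners even
   if the hyperplane misses the box. *)
pose e k := Num.max ((B k).1 ord0 i) (Num.min ((B k).2 ord0 i) c).
have le_e k : (B k).1 ord0 i <= e k by rewrite le_max lexx.
have e_le k : e k <= (B k).2 ord0 i by rewrite ge_max hB ge_min lexx.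
pose B1 k := ((B k).1, row_set (B k).2 i (e k)).
pose B2 k := (row_set (B k).1 i (e k), (B k).2).
have hB1 k j : (B1 k).1 ord0 j <= (B1 k).2 ord0 j.
  by rewrite mxE/=; case: eqP => [->|_].
have hB2 k j : (B2 k).1 ord0 j <= (B2 k).2 ord0 j.
  by rewrite mxE/=; case: eqP => [->|_].
have -> : (\sum_(k <oo) (box_volume (B k))%:E =
    \sum_(k <oo) (box_volume (B1 k))%:E + \sum_(k <oo) (box_volume (B2 k))%:E)%E.
  rewrite -nneseriesD => [|k _ _|k _ _]; rewrite ?lee_fin ?box_volume_ge0//.
  by apply: eq_eseriesr => k _; rewrite -EFinD box_volume_split -surjective_pairing.
apply: leeD; apply: ereal_inf_lbound; eexists => //; split=> // x [Xx Hx].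
- have [k _ Bkx] := XB _ Xx; exists k => // j /=.
  have /andP[h1 h2] := Bkx j; rewrite h1 mxE/=; case: eqP => // jE; subst j.
  by rewrite le_max le_min h2 (Hle _ Hx) orbT.
- have [k _ Bkx] := XB _ Xx; exists k => // j /=.
  have /andP[h1 h2] := Bkx j; rewrite h2 andbT mxE/=; case: eqP => // jE; subst j.
  rewrite ge_max h1 ge_min; apply/orP; right.
  by rewrite leNgt; apply/negP => /ltH.
Qed.

Lemma box_caratheodory ab : mu.-caratheodory (box ab).
Proof.
pose S i := [set x : 'rV[R]_m.+1 | ab.1 ord0 i <= x ord0 i <= ab.2 ord0 i].
have -> : box ab = ~` \bigcup_i ~` S i.
  rewrite setC_bigcup; apply/seteqP; split => x h i => [_|].
    by rewrite setCK; exact: h.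
  by have := h i Logic.I; rewrite setCK.
apply: caratheodory_measurable_setC.
apply: caratheodory_countable_bigcup => i; apply: caratheodory_measurable_setC.
have -> : S i = [set x : 'rV[R]_m.+1 | x ord0 i <= ab.2 ord0 i] `&`
    ~` [set x : 'rV[R]_m.+1 | x ord0 i < ab.1 ord0 i].
  apply/seteqP; split => [x /andP[h1 h2]|x [/= h2 /negP]].
    by split => //=; apply/negP; rewrite -leNgt.
  by rewrite /S/= -leNgt h2 andbT.
apply: caratheodory_measurable_setI.
  by apply: (@half_space_caratheodory i (ab.2 ord0 i)) => x //= /ltW.
apply: caratheodory_measurable_setC.
by apply: (@half_space_caratheodory i (ab.1 ord0 i)) => x //= /ltW.
Qed.

Lemma open_caratheodory (U : set 'rV[R]_m.+1) : open U -> mu.-caratheodory U.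
Proof.
move=> oU.
pose rbox (ab : 'rV[rat]_m.+1 * 'rV[rat]_m.+1) : set 'rV[R]_m.+1 :=
  box (map_mx ratr ab.1, map_mx ratr ab.2).
(* A rational box counts only if it lies in [U] and is replaced by the empty set otherwise; the
   index type stays countable. *)
pose S (ab : 'rV[rat]_m.+1 * 'rV[rat]_m.+1) :=
  [set x | rbox ab x /\ rbox ab `<=` U].
have -> : U = \bigcup_ab S ab.
  apply/seteqP; split=> [x Ux|x [ab _ [abx abU]]]; last exact: abU.
  have /nbhs_ballP[e/= e0 xeU] := open_nbhs_nbhs (conj oU Ux).
  have hq i : exists q : rat * rat,
      x ord0 i - e < ratr q.1 < x ord0 i /\ x ord0 i < ratr q.2 < x ord0 i + e.
    have /rat_in_itvoo[q1 h1] : x ord0 i - e < x ord0 i by rewrite gtrBl.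
    have /rat_in_itvoo[q2 h2] : x ord0 i < x ord0 i + e by rewrite ltrDl.
    by exists (q1, q2); move: h1 h2; rewrite !in_itv.
  have [q qP] := choice hq.
  exists (\row_i (q i).1, \row_i (q i).2) => //; split.
    by move=> i /=; rewrite !mxE; have [/andP[_ /ltW ->] /andP[/ltW ->]] := qP i.
  move=> y hy; apply: xeU; split => // k i.
  rewrite (ord1 k); have := hy i; rewrite /= !mxE => /andP[y1 y2].
  have [/andP[z1 _] /andP[_ z2]] := qP i.
  by rewrite /ball/= ltr_distlC; apply/andP; split; lra.
apply: caratheodory_countable_bigcup => ab.
have [abU|abU] := pselect (rbox ab `<=` U).
  rewrite (_ : S ab = rbox ab); first exact: box_caratheodory.
  by apply/seteqP; split=> [x []|].
rewrite (_ : S ab = set0); first exact: caratheodory_measurable_set0.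
by apply/seteqP; split=> [x []|].
Qed.

Lemma jordan_caratheodory A : jordan_measurable A -> mu.-caratheodory A.
Proof.
move=> [_ A0].
have -> : A = A° `|` (A `\` A°).
  by rewrite setDUK//; exact: interior_subset.
apply: caratheodory_measurable_setU.
  exact/open_caratheodory/open_interior.
apply: outer_measure_null_caratheodory.
apply/eqP; rewrite eq_le outer_measure_ge0 andbT -A0.
by apply: le_outer_measure; apply: setSD; exact: subset_closure.
Qed.

Lemma bounded_lebesgue_measure_lty A : bounded_set A -> (mu A < +oo)%E.
Proof.
move=> /bounded_setP[M AM].
have M' : A `<=` box (const_mx (- M), const_mx M).
  move=> x Ax i; rewrite /= !mxE -ler_norml.
  apply: le_trans (AM _ Ax).
  rewrite /Num.norm/= mx_normrE.
  exact: (le_bigmax _ (fun ij => `|x ij.1 ij.2|) (ord0, i)).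
have [|M0] := leP 0 M; last first.
  rewrite (_ : A = set0) ?outer_measure0 ?ltry//.
  apply/seteqP; split=> // x /M'/(_ ord0).
  by rewrite /= !mxE => /andP[a b]; move: M0 a b; lra.
move=> M0.
(* One box covers [A]; the cover must be a sequence, so it is padded with the point box at the
   origin, of volume 0 in positive dimension. *)
pose B k : 'rV[R]_m.+1 * 'rV[R]_m.+1 :=
  if k is 0 then (const_mx (- M), const_mx M) else (0, 0).
have hB k i : (B k).1 ord0 i <= (B k).2 ord0 i.
  by case: k => [|k]; rewrite !mxE//; lra.
apply: (@le_lt_trans _ _ (\sum_(k <oo) (box_volume (B k))%:E)%E).
  by apply: ereal_inf_lbound; exists B => //; split => // x /M' ?; exists 0%N.
rewrite nneseries_recl//; last by move=> k _; rewrite lee_fin box_volume_ge0.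
rewrite eseries0 ?adde0 ?ltry// => -[|k]// _ _; congr EFin.
by rewrite /box_volume (bigD1 ord0)//= subrr mul0r.
Qed.

End lebesgue_caratheodory.

(** * Boundaries of the pieces [Omega] *)

Section boundary.
Context {R : realType} {m : nat}.
Implicit Types (A : set 'rV[R]_m).

(** Off the boundary, membership is locally constant. In this form the property passes to finite
    Boolean combinations such as [Omega]. *)
Lemma notin_boundaryP A x : ~ boundary A x <-> \forall y \near x, A y <-> A x.
Proof.
have intP B : B° x -> \forall y \near x, B y <-> B x.
  by move=> Bx; apply: filterS (Bx) => y By; have := nbhs_singleton Bx; split.
split=> [/not_andP[|/contrapT /intP//]|xA [clx Ax]].
  rewrite -[~ _]/((~` closure A) x) -interiorC => /intP.
  by apply: filterS => y /= /iff_not2.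
have [Ax'|Ax'] := pselect (A x).
  by apply: Ax; apply: filterS xA => y [_]; exact.
suff : (~` A)° x by rewrite interiorC; exact.
by apply: filterS xA => y [+ _] => /[apply].
Qed.

Lemma boundary_Omega n (A : 'I_n.+1 -> set 'rV[R]_m) (chi : {set 'I_n.+1}) :
  boundary (Omega A chi) `<=` \bigcup_i boundary (A i).
Proof.
move=> x; apply: contraPP => xA; apply/notin_boundaryP.
have : \forall y \near x, forall i, A i y <-> A i x.
  apply: (@filter_forall _ 'I_n.+1 (fun i y => A i y <-> A i x) _
    (nbhs_filter x)) => i; apply/notin_boundaryP => xAi.
  by apply: xA; exists i.
rewrite /Omega; case: ifPn => _; apply: filterS => // y yx.
split=> -[h1 h2]; split => [k /h1 /yx//|[k kc /yx Akx]].
- by apply: h2; exists k.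
- by apply: h2; exists k.
Qed.

End boundary.

(** * Distance of a node to the partition average *)

Section partition_average.
Context {R : realType} {m : nat}.
Local Notation mu := (@lebesgue_measure_rV R m.+1).
Variables (n : nat) (A : 'I_n.+1 -> set 'rV[R]_m.+1).
Hypothesis jA : forall i, jordan_measurable (A i).

Lemma Omega_jordan_measurable (chi : {set 'I_n.+1}) :
  jordan_measurable (Omega A chi).
Proof.
split.
  rewrite /Omega; case: ifPn => [_|/set0Pn[k kchi]].
    by apply/bounded_setP; exists 0.
  have [/bounded_setP[M AM] _] := jA k.
  by apply/bounded_setP; exists M => x [/(_ k kchi) /AM].
apply/eqP; rewrite eq_le outer_measure_ge0 andbT.
apply: le_trans (le_outer_measure _ _ _ (@boundary_Omega _ _ _ A chi)) _.
have -> : [set: 'I_n.+1] = [set` enum 'I_n.+1].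
  by apply/seteqP; split => i // _ /=; rewrite mem_enum.
apply: le_trans (outer_measure_bigcup_seq _ _ _) _.
by rewrite big1// => i _; have [] := jA i.
Qed.

Lemma Omega_trivIset : trivIset setT (Omega A).
Proof.
apply/trivIsetP => chi chi' _ _; apply: contra_neqP => /eqP/set0P[x [h h']].
apply/setP => i.
wlog suff aux : chi chi' h h' / i \in chi -> i \in chi'.
  by apply/idP/idP; exact: aux.
move: h h'; rewrite /Omega; case: ifPn => // _; case: ifPn => // _.
move=> [h1 h2] [h1' h2'] ichi; apply: contrapT => ichi'; apply: h2'.
by exists i; [rewrite /= inE; exact/negP|exact: h1].
Qed.

Lemma OmegaP (chi : {set 'I_n.+1}) x i : Omega A chi x -> i \in chi <-> A i x.
Proof.
rewrite /Omega; case: ifPn => // _ [h1 h2]; split; first exact: h1.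
move=> Aix; apply: contrapT => ic; apply: h2; exists i => //=.
by rewrite inE; exact/negP.
Qed.

Lemma Omega_cover x i : A i x ->
  exists2 chi : {set 'I_n.+1}, i \in chi & Omega A chi x.
Proof.
(* The witness is the membership pattern of [x]; it contains [i], so the empty default of [Omega] is
   avoided. *)
move=> Aix; exists [set k | `[< A k x >]]%SET; first by rewrite inE; apply/asboolP.
rewrite /Omega ifF; last first.
  by apply/negbTE/set0Pn; exists i; rewrite inE; apply/asboolP.
split=> [k /=|[k /=]]; first by rewrite inE => /asboolP.
by rewrite !inE => /asboolPn.
Qed.

Variables (Psi : set 'rV[R]_m.+1 -> R -> set 'rV[R]_m.+1) (alpha : 'I_n.+1 -> R).
Hypothesis gen : subset_generating Psi.
Hypothesis alpha_ge0 : forall i, 0 <= alpha i.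
Hypothesis sum_alpha : \sum_i alpha i = 1.

Lemma partial_weight_itv01 (chi : {set 'I_n.+1}) : 0 <= \sum_(k in chi) alpha k <= 1.
Proof.
rewrite sumr_ge0//= -sum_alpha [leRHS](bigID [in chi])/= lerDl.
exact: sumr_ge0.
Qed.

(** Cutting [Psi B t] along [B] shows that their intersection has measure at least [t mu(B)], the
    overhang being null. Then [B] is cut along [Psi B t], and [mu(B)] is finite, hence can be
    subtracted. *)
Lemma generated_subset_codist_le B t : jordan_measurable B -> 0 <= t <= 1 ->
  (mu (B `\` Psi B t) <= (1 - t)%:E * mu B)%E.
Proof.
move=> jB t01; have [_ jP] := subset_generating_regular gen jB t01.
have muB : mu B \is a fin_num.
  rewrite ge0_fin_numE ?outer_measure_ge0//.
  by apply: bounded_lebesgue_measure_lty; case: jB.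
have le1 : (mu (Psi B t) <= mu (B `&` Psi B t))%E.
  rewrite (jordan_caratheodory jB (Psi B t)) -setDE.
  by rewrite (subset_generating_sub gen jB t01) adde0 setIC.
rewrite (subset_generating_measure gen jB t01) in le1.
have := jordan_caratheodory jP B; rewrite -setDE => E.
have : (mu (B `\` Psi B t) + t%:E * mu B <= mu B)%E.
  by rewrite [leRHS]E addeC leeD2r.
rewrite -leeBrDr ?fin_numM// => /le_trans; apply.
by rewrite -(fineK muB) -!EFinM -EFinB lee_fin mulrBl mul1r.
Qed.

(** The bounds [D] keep the weighted sum real; they will be Hölder bounds, or 0 when [nu >= 2]. *)
Lemma partition_average_dist_le (j : 'I_n.+1) (D : 'I_n.+1 -> R) :
  (forall i, (dmu (A j) (A i) <= (D i)%:E)%E) ->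
  (dmu (A j) (partition_average Psi alpha A) <= (\sum_i alpha i * D i)%:E)%E.
Proof.
move=> AD; pose O := Omega A.
pose w (chi : {set 'I_n.+1}) := \sum_(k in chi) alpha k.
pose v chi := fine (mu (O chi)).
have jO chi : jordan_measurable (O chi) by exact: Omega_jordan_measurable.
have vE chi : mu (O chi) = (v chi)%:E.
  rewrite fineK// ge0_fin_numE ?outer_measure_ge0//.
  by apply: bounded_lebesgue_measure_lty; case: (jO chi).
have v0 chi : 0 <= v chi by rewrite -lee_fin -vE outer_measure_ge0.
(* When this holds, the piece lies in exactly one of [A i] and [A j]. *)
pose sep i (chi : {set 'I_n.+1}) := (i \in chi) (+) (j \in chi).
pose e chi := \sum_(i | sep i chi) alpha i.
have eE chi : e chi = if j \in chi then 1 - w chi else w chi.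
  rewrite /e /sep /w; case: ifPn => jc.
    rewrite -sum_alpha [X in X - _](bigID [in chi])/= addrAC subrr add0r.
    by apply: eq_bigl => i; rewrite addbT.
  by apply: eq_bigl => i; rewrite addbF.
(* The error charged to [chi]: what is lost from a piece inside [A j], or what is added by a piece
   outside. The overhang of [Psi] beyond its piece is null but not empty, so it must be covered
   too. *)
pose G (chi : {set 'I_n.+1}) := if j \in chi then (O chi `\` Psi (O chi) (w chi)) `|`
  (Psi (O chi) (w chi) `\` O chi) else Psi (O chi) (w chi).
have muG chi : (mu (G chi) <= (e chi * v chi)%:E)%E.
  have w01 := partial_weight_itv01 chi.
  rewrite eE /G EFinM -vE; case: ifPn => jc; last first.
    by rewrite (subset_generating_measure gen).
  apply: le_trans (outer_measureU2 _ _ _) _.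
  rewrite [X in (_ + X)%E](subset_generating_sub gen (jO chi) w01) adde0.
  exact: generated_subset_codist_le.
have sub : A j `+` partition_average Psi alpha A `<=`
    \bigcup_(chi in [set` enum {set 'I_n.+1}]) G chi.
  move=> x [[Ajx Ux]|[[chi _ Px] Ajx]].
    have [chi jc Ox] := Omega_cover Ajx.
    exists chi; first by rewrite /= mem_enum.
    rewrite /G jc; left; split => // Px; apply: Ux.
    by exists chi.
  exists chi; first by rewrite /= mem_enum.
  rewrite /G; case: ifPn => // jc; right; split => // Ox.
  exact/Ajx/(OmegaP j Ox).
apply: (le_trans (le_outer_measure _ _ _ sub)).
apply: le_trans (outer_measure_bigcup_seq _ _ _) _.
apply: (@le_trans _ _ (\sum_chi e chi * v chi)%:E).
  by rewrite big_enum/= -sumEFin lee_sum.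
rewrite lee_fin.
(* Exchanging the sums groups the error by node: for each [i], the pieces separating [i] from [j]
   are disjoint parts of the symmetric difference of [A j] and [A i]. *)
have -> : \sum_chi e chi * v chi = \sum_i alpha i * \sum_(chi | sep i chi) v chi.
  under eq_bigr do rewrite mulr_suml.
  under [RHS]eq_bigr do rewrite mulr_sumr.
  by rewrite (exchange_big_dep xpredT).
apply: ler_sum => i _; rewrite ler_wpM2l// -lee_fin -sumEFin.
apply: le_trans (AD i).
have us : uniq [seq chi <- index_enum {set 'I_n.+1} | sep i chi].
  by rewrite filter_uniq// index_enum_uniq.
have mO chi := jordan_caratheodory (jO chi).
apply: le_trans (caratheodory_sum_le us mO Omega_trivIset (A j `+` A i)).
rewrite big_filter.
apply: lee_sum => chi sc; rewrite -vE; apply: le_outer_measure => x Ox; split => //.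
have hi := OmegaP i Ox; have hj := OmegaP j Ox.
move: sc; rewrite /sep.
case: (boolP (i \in chi)) => ic; case: (boolP (j \in chi)) => jc//= _.
  by right; split; [exact/hi|move/hj; exact/negP].
by left; split; [exact/hj|move/hi; exact/negP].
Qed.

End partition_average.

(** * Hölder continuous set-valued functions *)

Section hoelder_set_function.
Context {R : realType} {m : nat}.
Local Notation mu := (@lebesgue_measure_rV R m.+1).
Implicit Types A B C : set 'rV[R]_m.+1.

Lemma dmu_triangle B A C : (dmu A C <= dmu A B + dmu B C)%E.
Proof.
apply: le_trans (outer_measureU2 _ _ _); apply: le_outer_measure => x.
by have [Bx|Bx] := pselect (B x) => -[[Ax Cx]|[Cx Ax]];
  [right; left|left; right|left; left|right; right].
Qed.

Variables (L nu : R) (F : R -> set 'rV[R]_m.+1).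
Hypothesis L_ge0 : 0 <= L.
Hypothesis F_hoelder : forall x y : R, 0 <= x <= 1 -> 0 <= y <= 1 ->
  (dmu (F x) (F y) <= (L * `|x - y| `^ nu)%:E)%E.

(** The segment is divided into [N + 1] equal steps, joined by the triangle inequality. *)
Lemma hoelder_chain_le (N : nat) (x y : R) : 0 <= x <= 1 -> 0 <= y <= 1 ->
  (dmu (F x) (F y) <= (N.+1%:R * (L * (`|x - y| / N.+1%:R) `^ nu))%:E)%E.
Proof.
move=> /andP[x0 x1] /andP[y0 y1].
have N0 : 0 < N.+1%:R :> R by [].
pose z k : R := x + k%:R / N.+1%:R * (y - x).
have z01 k : (k <= N.+1)%N -> 0 <= z k <= 1.
  move=> kN; rewrite /z; have : 0 <= (k%:R / N.+1%:R : R) <= 1.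
    by rewrite divr_ge0//= ler_pdivrMr// mul1r ler_nat.
  by move: (_ / _) => t /andP[t0 t1]; apply/andP; split; nra.
have zN : z N.+1 = y by rewrite /z divff ?gt_eqF// mul1r subrKC.
suff chain k : (k <= N.+1)%N ->
    (dmu (F x) (F (z k)) <= (k%:R * (L * (`|x - y| / N.+1%:R) `^ nu))%:E)%E.
  by rewrite -{1}zN chain.
elim: k => [_|k IH kN].
  rewrite /z mul0r mul0r addr0 /dmu setYK mul0r.
  by rewrite (_ : mu set0 = 0%E)// outer_measure0.
apply: le_trans (dmu_triangle (F (z k)) _ _) _.
rewrite -natr1 mulrDl mul1r EFinD; apply: leeD; first exact/IH/ltnW.
apply: le_trans (F_hoelder (z01 _ (ltnW kN)) (z01 _ kN)) _.
rewrite (_ : z k - z k.+1 = (x - y) / N.+1%:R).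
  by rewrite normrM (@ger0_norm _ _^-1)// invr_ge0 ltW.
by rewrite /z -[k.+1%:R]natr1; field; rewrite addrC natr1 gt_eqF.
Qed.

(** Since [|x - y| <= 1], a chain of [N + 1] steps costs at most [L / (N + 1)], which is arbitrarily
    small. *)
Lemma hoelder_ge2_constant (x y : R) : 2 <= nu -> 0 <= x <= 1 -> 0 <= y <= 1 ->
  (dmu (F x) (F y) <= 0)%E.
Proof.
move=> nu2 x01 y01; apply/lee_addgt0Pr => e e0; rewrite add0e.
pose N := Num.truncn (L / e).
apply: le_trans (hoelder_chain_le N x01 y01) _; rewrite lee_fin.
have N0 : 0 < N.+1%:R :> R by [].
have xy1 : `|x - y| <= 1.
  rewrite ler_norml; move: x01 y01 => /andP[? ?] /andP[? ?].
  by apply/andP; split; lra.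
apply: (@le_trans _ _ (N.+1%:R * (L * N.+1%:R^-1 ^+ 2))).
  rewrite ler_wpM2l ?(ltW N0)// ler_wpM2l//.
  apply: (@le_trans _ _ (N.+1%:R^-1 `^ nu)).
    apply: ge0_ler_powR; rewrite ?nnegrE ?divr_ge0 ?invr_ge0 ?(ltW N0)//; first lra.
    by rewrite ler_pdivrMr// mulVf// gt_eqF.
  rewrite -powR_mulrn ?invr_ge0 ?(ltW N0)//; apply: ger_powR => //.
  by rewrite invr_gt0 N0 invf_le1//= ler1n.
rewrite (_ : _ * _ = L / N.+1%:R); last by field; rewrite addrC natr1 gt_eqF.
rewrite ler_pdivrMr// mulrC -ler_pdivrMr//.
by rewrite ltW// truncnS_gt.
Qed.

End hoelder_set_function.

Theorem theorem4p5 (R : realType) (m : nat) (m_ge1 : (1 <= m)%N)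
    (Psi : set 'rV[R]_m -> R -> set 'rV[R]_m)
    (Psi_gen : subset_generating Psi)
    (nu L : R) (nu_gt0 : 0 < nu) (L_ge0 : 0 <= L)
    (F : R -> set 'rV[R]_m)
    (F_regular : forall x : R, 0 <= x <= 1 -> regular_jordan (F x))
    (F_hoelder : forall x y : R, 0 <= x <= 1 -> 0 <= y <= 1 ->
      (dmu (F x) (F y) <= (L * `|x - y| `^ nu)%:E)%E)
    (n : nat) (n_ge1 : (1 <= n)%N) (x : R) (x01 : 0 <= x <= 1) :
  (dmu (F x) (bernstein_operator Psi n F x) <=
   (L * (1 / n%:R) `^ nu + L * (x * (1 - x) / n%:R) `^ (nu / 2))%:E)%E.
Proof.
(* The outer measure structure lives in dimension [m.+1]. *)
case: m m_ge1 Psi Psi_gen F F_regular F_hoelder => // m _ Psi gen F Freg hF.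
have /andP[x0 x1] := x01.
have n0 : 0 < n%:R :> R by rewrite ltr0n.
have node01 (i : 'I_n.+1) : 0 <= (i%:R / n%:R : R) <= 1.
  by rewrite divr_ge0 ?ler0n//= ler_pdivrMr// mul1r ler_nat -ltnS.
have jF (i : 'I_n.+1) : jordan_measurable (F (i%:R / n%:R)).
  by have [] := Freg _ (node01 i).
pose alpha (i : 'I_n.+1) := 'C(n, i)%:R * x ^+ i * (1 - x) ^+ (n - i).
have alpha0 i : 0 <= alpha i by rewrite !mulr_ge0 ?exprn_ge0 ?subr_ge0.
have alpha1 : \sum_i alpha i = 1 := sum_bernstein n x.
have nx : 0 <= n%:R * x <= n%:R by rewrite mulr_ge0 ?(ltW n0)//= ger_pMr.
have [j [d12 dy dny]] := nearest_node nx.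
apply: le_trans (dmu_triangle (F (j%:R / n%:R)) _ _) _.
have avg := partition_average_dist_le jF gen alpha0 alpha1.
have [nu2|nu2] := leP 2 nu.
  have cst := hoelder_ge2_constant L_ge0 hF nu2.
  have := avg j (fun=> 0) (fun i => cst _ _ (node01 j) (node01 i)).
  rewrite big1 => [|i _]; last by rewrite mulr0.
  move=> /(leeD (cst _ _ x01 (node01 j))) /le_trans; apply.
  by rewrite adde0 lee_fin addr_ge0// mulr_ge0// powR_ge0.
pose u := nu / 2.
have u01 : 0 < u <= 1 by rewrite /u; apply/andP; split; lra.
have nuE : nu = 2 * u by rewrite /u mulrC divfK.
set d := `|n%:R * x - j%:R| in d12 dy dny.
pose S := n%:R * x * (1 - x).
(* One factor [d] is bounded by [1/2], the other by the distance from [n x] to the nearer endpoint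
   of [[0, n]]. *)
have dS : d ^+ 2 <= S.
  have [x12|x12] := leP x (1 / 2).
    apply: (@le_trans _ _ (n%:R * x * (1 / 2))).
      by rewrite expr2 ler_pM ?normr_ge0.
    by rewrite /S ler_wpM2l ?mulr_ge0 ?(ltW n0)//; lra.
  apply: (@le_trans _ _ ((n%:R - n%:R * x) * (1 / 2))).
    by rewrite expr2 ler_pM ?normr_ge0.
  rewrite /S (_ : n%:R - n%:R * x = n%:R * (1 - x)); last by ring.
  by rewrite [leRHS]mulrAC ler_wpM2l ?mulr_ge0 ?subr_ge0 ?(ltW n0)// ltW.
(* Besides extracting [n^-nu], this writes powers of distances as powers of squares, whose average
   is known. *)
have scale t : (`|t| / n%:R) `^ nu = (1 / n%:R) `^ nu * (t ^+ 2) `^ u.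
  rewrite -real_normK ?num_real// -powR_mulrn ?normr_ge0// -powRrM -nuE.
  by rewrite -powRM ?normr_ge0 ?divr_ge0 ?(ltW n0)// mul1r mulrC.
have dist (s t : R) : `|s / n%:R - t / n%:R| = `|s - t| / n%:R.
  by rewrite -mulrBl normrM (@ger0_norm _ _^-1)// invr_ge0 ltW.
have := avg j _ (fun i => hF _ _ (node01 j) (node01 i)).
move=> /(leeD (hF _ _ x01 (node01 j))) /le_trans; apply.
rewrite -EFinD lee_fin.
have -> : `|x - j%:R / n%:R| = d / n%:R.
  by rewrite -dist mulrAC divff ?mul1r ?gt_eqF.
under eq_bigr => i _ do rewrite dist scale -sqrrN opprB [alpha i * _]mulrCA
  [alpha i * _]mulrCA.
rewrite -!mulr_sumr -mulrDr -mulrDr ler_wpM2l//.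
have -> : (d / n%:R) `^ nu = (1 / n%:R) `^ nu * d `^ nu.
  by rewrite mulrC -powRM ?normr_ge0 ?divr_ge0 ?(ltW n0)// mul1r mulrC.
(* Here [x (1 - x) / n = S / n^2], and [2 u = nu]. *)
have -> : (x * (1 - x) / n%:R) `^ u = (1 / n%:R) `^ nu * S `^ u.
  rewrite nuE powRrM powR_mulrn ?divr_ge0 ?(ltW n0)// -powRM.
  - by congr powR; rewrite /S; field; rewrite gt_eqF.
  - by rewrite exprn_ge0// divr_ge0// ltW.
  - exact: le_trans (exprn_ge0 _ (normr_ge0 _)) dS.
rewrite -mulrDr -[X in _ <= X + _]mulr1 -mulrDr ler_wpM2l ?powR_ge0//.
(* The factors [L] and [n^-nu] are gone. Jensen and the second moment about [j] bound the remaining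
   average by [(S + d^2)^u]. *)
apply: le_trans (powR_nearest_node_bound _ dS u01).
  rewrite -nuE lerD2l.
  apply: le_trans (powR_jensen alpha0 alpha1 _ u01) _.
    by move=> i; exact: sqr_ge0.
  by rewrite bernstein_sqr_dist /d real_normK ?num_real.
by rewrite normr_ge0.
Qed.
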